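(* Let $n\ge1$, let $\Delta:=(\sqrt{n+1})^{n+1}$, let $X\subseteq\{0,1\}^n$ be non-empty and let $r:=\operatorname{xc}(\operatorname{conv}(X))$. Then there exist matrices $\bar A\in\mathbb{Z}^{(n+r)\times n}$, $\bar U\in\big(\tfrac{1}{4r(n+r)\Delta}\mathbb{Z}_{\ge 0}\big)^{(n+r)\times r}$ and a vector $\bar b\in\mathbb{Z}^{n+r}$ with $\|\bar A\|_\infty,\|\bar b\|_\infty,\|\bar U\|_\infty\le\Delta$ such that \[ X=\Big\{x\in\{0,1\}^n \;\Big|\; \exists y\in[0,\Delta]^r:\ \|\bar A x+\bar U y-\bar b\|_\infty\le \tfrac{1}{4(n+r)}\Big\}. \]
   Context: For a polytope $P\subseteq\mathbb{R}^n$, an extension is a polyhedron $Q\subseteq\mathbb{R}^m$ with a linear map $p:\mathbb{R}^m\to\mathbb{R}^n$ such that $p(Q)=P$; an extended formulation is a description $Q=\{z\mid Cz\le c,\ Dz=d\}$, whose size is the number of inequalities (rows of $C$). The extension complexity $\operatorname{xc}(P)$ is the minimum size of an extended formulation of $P$. For $q\in\mathbb{R}$, $q\mathbb{Z}_{\ge0}=\{0,q,2q,\ldots\}$. $\|\cdot\|_\infty$ of a matrix or vector is the maximum absolute value of an entry. *)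

(* Defs.v *)
From HB Require Import structures.
From mathcomp Require Import all_boot all_order all_algebra.
From mathcomp Require Import reals.
Set Implicit Arguments. Unset Strict Implicit. Unset Printing Implicit Defensive.
Import Order.TTheory GRing.Theory Num.Theory.
Local Open Scope ring_scope.

Definition cvle (R : realType) (k : nat) (u v : 'cV[R]_k) : Prop :=
  forall i, u i 0 <= v i 0.

Definition vec01 (R : realType) (n : nat) (v : {ffun 'I_n -> bool}) : 'cV[R]_n :=
  \col_i (v i)%:R.

Definition conv01 (R : realType) (n : nat) (X : {set {ffun 'I_n -> bool}})
  : 'cV[R]_n -> Prop :=
  fun x => exists lam : {ffun {ffun 'I_n -> bool} -> R},
    [/\ forall v, 0 <= lam v, forall v, v \notin X -> lam v = 0,
        \sum_v lam v = 1 & x = \sum_v lam v *: @vec01 R n v].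

Definition has_ext_form (R : realType) (n : nat) (P : 'cV[R]_n -> Prop) (k : nat)
  : Prop :=
  exists (m l : nat) (C : 'M[R]_(k, m)) (c : 'cV[R]_k)
         (D : 'M[R]_(l, m)) (d : 'cV[R]_l) (p : 'M[R]_(n, m)),
    forall x : 'cV[R]_n,
      P x <-> exists z : 'cV[R]_m, [/\ cvle (C *m z) c, D *m z = d & x = p *m z].

Definition is_xc (R : realType) (n : nat) (P : 'cV[R]_n -> Prop) (r : nat) : Prop :=
  has_ext_form P r /\ forall k, has_ext_form P k -> (r <= k)%N.

(* Main.v *)
(** If [v] is a 0/1 point outside [X], a linear functional separating [v] from [X] that is tight
    on as many points of [X] and coordinate hyperplanes as possible is determined up to scaling
    by the vectors it annihilates, so it is a cofactor vector of a 0/1 matrix of order [n + 1];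
    by Hadamard's inequality its coefficients and its slacks on [X] are integers bounded by
    [Delta].  By Farkas' lemma (Yannakakis), the slack matrix of these tight inequalities factors
    through nonnegative vectors of length [r], which gives a system [A x + U y = b].  Choosing
    at most [n + r] rows of [(A, U)] of maximal volume, every row is a combination of
    the chosen ones with coefficients in [-1, 1].  A point [v] outside [X] violates its own
    row by at least 1, hence some chosen row by at least [1 / (n + r)], which is more than what
    rounding [U] down to the grid can hide. *)

Require Import Defs.
From HB Require Import structures.
From mathcomp Require Import all_boot all_order all_algebra.
From mathcomp Require Import boolp reals ring lra.
Import Order.TTheory GRing.Theory Num.Theory.
Set Implicit Arguments. Unset Strict Implicit. Unset Printing Implicit Defensive.
Local Open Scope ring_scope.

(** * Farkas' lemma, homogeneous and affine *)

(* Bartl's induction on the number of inequalities: if dropping the first inequality [a]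
   loses the implication, project along a witness [x0] of the failure onto [ker a]. *)
Lemma farkas (R : realFieldType) (m k : nat) (A : 'M[R]_(k, m)) (g : 'rV[R]_m) :
  (forall z : 'cV[R]_m, (forall i, (A *m z) i 0 <= 0) -> (g *m z) 0 0 <= 0) ->
  exists2 u : 'rV[R]_k, forall i, 0 <= u 0 i & g = u *m A.
Proof.
elim: k A g => [|k IHk] A g hg.
  exists 0 => [i|]; first by rewrite mxE.
  rewrite mul0mx; apply/rowP => j; rewrite mxE.
  pose e : 'cV[R]_m := delta_mx j 0.
  have ge : (g *m e) 0 0 = g 0 j by rewrite -colE mxE.
  have h1 := hg e (fun i => False_ind _ (notF (ltn_ord i))).
  have h2 := hg (- e) (fun i => False_ind _ (notF (ltn_ord i))).
  by rewrite mulmxN mxE ge oppr_le0 in h2; rewrite ge in h1; apply/eqP; rewrite eq_le h1.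
move: A hg; rewrite -[k.+1]/(1 + k)%N => A; rewrite -[A]vsubmxK.
set a := usubmx A; set B := dsubmx A => hg.
have splitA (z : 'cV[R]_m) :
    (forall i, (B *m z) i 0 <= 0) -> (a *m z) 0 0 <= 0 -> (g *m z) 0 0 <= 0.
  move=> hB ha; apply: hg => i; rewrite mul_col_mx.
  by case: (split_ordP i) => j ->; rewrite (col_mxEu, col_mxEd) ?(ord1 j).
have [hB|] := pselect (forall z : 'cV[R]_m,
    (forall i, (B *m z) i 0 <= 0) -> (g *m z) 0 0 <= 0).
  have [u u0 ->] := IHk _ _ hB.
  exists (row_mx 0 u) => [i|]; last by rewrite mul_row_col mul0mx add0r.
  by case: (split_ordP i) => j ->; rewrite (row_mxEl, row_mxEr) ?mxE.
move=> /existsNP[x0 /not_implyP[hB /negP]]; rewrite -ltNge => gx0.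
have ax0 : 0 < (a *m x0) 0 0.
  by rewrite ltNge; apply/negP => h; have := splitA _ hB h; rewrite leNgt gx0.
pose s := ((a *m x0) 0 0)^-1.
have s0 : 0 < s by rewrite invr_gt0.
pose P : 'M[R]_m := 1%:M - s *: (x0 *m a).
have aP : a *m P = 0.
  rewrite mulmxBr mulmx1 -scalemxAr mulmxA [a *m x0]mx11_scalar mul_scalar_mx scalerA.
  by rewrite mulVf ?gt_eqF // scale1r subrr.
have [|u u0 hu] := IHk (B *m P) (g *m P).
  move=> z hz; rewrite -mulmxA; apply: splitA => [i|]; first by rewrite mulmxA hz.
  by rewrite mulmxA aP mul0mx mxE.
(* This multiplier of [a] makes both sides agree at [x0]; it is nonnegative because [u *m (B *m x0)]
   is at most 0 while [g] is positive at [x0]. *)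
pose t := s * ((g *m x0) 0 0 - (u *m (B *m x0)) 0 0).
exists (row_mx t%:M u) => [i|].
  case: (split_ordP i) => j ->; rewrite (row_mxEl, row_mxEr) ?(ord1 j) //.
  rewrite mxE eqxx mulr1n mulr_ge0 ?ltW // subr_gt0.
  apply: le_lt_trans gx0; rewrite mxE; apply: sumr_le0 => l _.
  by rewrite mulr_ge0_le0.
rewrite mul_row_col mul_scalar_mx.
move: hu; rewrite mulmxA !mulmxBr !mulmx1 -!scalemxAr !mulmxA.
rewrite [g *m x0]mx11_scalar [u *m B *m x0]mx11_scalar !mul_scalar_mx !scalerA.
move=> /eqP; rewrite subr_eq => /eqP ->.
by rewrite /t mulrBr scalerBl mulmxA addrAC -addrA addrC.
Qed.

(** Homogenization by an extra coordinate [t] reduces this to [farkas]: the cone is [C x <= t c],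
    [D x = t d], [0 <= t], the functional [g x - t beta]. The feasible point [z0] settles the case
    [t = 0]. *)
Lemma farkas_affine (R : realFieldType) (m k l : nat) (C : 'M[R]_(k, m)) (c : 'cV[R]_k)
    (D : 'M[R]_(l, m)) (d : 'cV[R]_l) (g : 'rV[R]_m) (beta : R) (z0 : 'cV[R]_m) :
  (forall i, (C *m z0) i 0 <= c i 0) -> D *m z0 = d ->
  (forall z : 'cV[R]_m, (forall i, (C *m z) i 0 <= c i 0) -> D *m z = d ->
     (g *m z) 0 0 <= beta) ->
  exists (u : 'rV[R]_k) (w : 'rV[R]_l),
    [/\ forall i, 0 <= u 0 i, g = u *m C + w *m D
      & (u *m c + w *m d) 0 0 <= beta].
Proof.
move=> Cz0 Dz0 hg.
pose A : 'M[R]_(k + (l + (l + 1)), m + 1) :=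
  col_mx (row_mx C (- c)) (col_mx (row_mx D (- d))
    (col_mx (row_mx (- D) d) (row_mx 0 (- 1%:M)))).
have [z|v v0] := @farkas _ _ _ A (row_mx g (- beta%:M)).
  have [x [t ->]] : exists x t, z = col_mx x t%:M.
    by exists (usubmx z), (dsubmx z 0 0); rewrite -mx11_scalar vsubmxK.
  rewrite /A => hz.
  have hC i : (C *m x) i 0 <= t * c i 0.
    have := hz (lshift _ i); rewrite mul_col_mx col_mxEu mul_row_col mul_mx_scalar.
    by move: (C *m x) => y; rewrite !mxE mulrN subr_le0.
  have hD : D *m x = t *: d.
    apply/colP => i; apply/eqP; rewrite eq_le; apply/andP; split.
      have := hz (rshift _ (lshift _ i)).
      rewrite mul_col_mx col_mxEd mul_col_mx col_mxEu mul_row_col mul_mx_scalar.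
      by move: (D *m x) => y; rewrite !mxE mulrN subr_le0.
    have := hz (rshift _ (rshift _ (lshift _ i))).
    rewrite mul_col_mx col_mxEd mul_col_mx col_mxEd mul_col_mx col_mxEu mul_row_col.
    rewrite mul_mx_scalar mulNmx.
    by move: (D *m x) => y; rewrite !mxE addrC subr_le0.
  have t_ge0 : 0 <= t.
    have := hz (rshift _ (rshift _ (rshift _ 0))).
    rewrite !mul_col_mx !col_mxEd mul_row_col mul0mx add0r mulNmx mul1mx !mxE.
    by rewrite mulr1n oppr_le0.
  rewrite mul_row_col mul_mx_scalar.
  suff : (g *m x) 0 0 <= t * beta.
    by move: (g *m x) => y; rewrite !mxE mulr1n mulrN subr_le0.
  have [t0|t_gt0] := eqVneq t 0; last first.
    have {}t_gt0 : 0 < t by rewrite lt_neqAle eq_sym t_gt0.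
    suff : (g *m (t^-1 *: x)) 0 0 <= beta by rewrite -scalemxAr mxE ler_pdivrMl.
    apply: hg => [i|]; first by rewrite -scalemxAr mxE ler_pdivrMl.
    by rewrite -scalemxAr hD scalerA mulVf ?scale1r ?gt_eqF.
  rewrite t0 mul0r leNgt; apply/negP => gx.
  (* Here [x] is a recession direction; if [g] grew along it, the step [s] from [z0] would reach the
     value [beta + 1]. *)
  pose s := (beta - (g *m z0) 0 0 + 1) / (g *m x) 0 0.
  have b0 : (g *m z0) 0 0 <= beta by exact: hg.
  have s0 : 0 <= s by apply: divr_ge0; [rewrite addr_ge0 ?subr_ge0 | exact: ltW].
  have : (g *m (z0 + s *: x)) 0 0 <= beta.
    apply: hg => [i|]; last by rewrite mulmxDr -scalemxAr hD t0 scale0r scaler0 addr0.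
    rewrite mulmxDr -scalemxAr mxE [X in _ + X]mxE -[c i 0]addr0 lerD // mulr_ge0_le0 //.
    by have := hC i; rewrite t0 mul0r.
  by rewrite mulmxDr -scalemxAr mxE [X in _ + X]mxE divfK ?gt_eqF //; lra.
rewrite -[v]hsubmxK; set u := lsubmx v; rewrite -[rsubmx v]hsubmxK.
set w1 := lsubmx _; set v1 := rsubmx (rsubmx v).
rewrite -[v1]hsubmxK; set w2 := lsubmx v1; set s := rsubmx v1.
rewrite !mul_row_col !mul_mx_row !add_row_mx mulmx0 addr0.
rewrite !mulmxN mulmx1 => /eq_row_mx[-> eb].
exists u, (w1 - w2); split => [i| |]; first by rewrite mxE.
  by rewrite mulmxBl.
have := congr1 (fun M : 'M_1 => M 0 0) eb.
have s0 : 0 <= s 0 0 by rewrite !mxE.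
rewrite mulmxBl; move: (u *m c) (w1 *m d) (w2 *m d) s0 => a b e.
by rewrite !mxE mulr1n; lra.
Qed.

(** * Yannakakis' factorization of slacks *)

(** Each [x] in [X] lifts to a point [z x] of the extension. By Farkas, the slack at [x] of a tight
    valid inequality is a nonnegative combination of the slacks [c - C z x]. Rescaling these to
    maximum 1 over [X], unless they vanish there, bounds the weights by [B]. *)
Lemma slack_factorization (R : realType) (n : nat) (X : {set {ffun 'I_n -> bool}}) (r : nat) :
  X != set0 -> has_ext_form (@conv01 R n X) r ->
  exists V : {ffun 'I_n -> bool} -> 'cV[R]_r,
    (forall x j, x \in X -> 0 <= V x j 0 <= 1) /\
    forall (a : 'rV[R]_n) (beta B : R), 0 <= B ->
      (forall x, x \in X -> 0 <= beta - (a *m vec01 R x) 0 0 <= B) ->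
      (exists2 x, x \in X & (a *m vec01 R x) 0 0 = beta) ->
    exists2 u : 'rV[R]_r, forall j, 0 <= u 0 j <= B &
      forall x, x \in X -> (a *m vec01 R x + u *m V x) 0 0 = beta.
Proof.
move=> /set0Pn[x1 x1X] [m [l [C [c [D [d [p hP]]]]]]].
have conv_mem x : x \in X -> conv01 X (vec01 R x).
  move=> xX; exists [ffun y => (y == x)%:R]; split=> [y|y yX||].
  - by rewrite ffunE ler0n.
  - by rewrite ffunE; case: eqP yX xX => // -> /negP.
  - by rewrite (bigD1 x) //= ffunE eqxx big1 ?addr0 // => y /negPf h; rewrite ffunE h.
  - rewrite (bigD1 x) //= ffunE eqxx scale1r big1 ?addr0 // => y /negPf h.
    by rewrite ffunE h scale0r.
have /choice[z hz] : forall x, exists z : 'cV[R]_m, x \in X ->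
    [/\ forall i, (C *m z) i 0 <= c i 0, D *m z = d & vec01 R x = p *m z].
  move=> x; have [xX|_] := boolP (x \in X); last by exists 0.
  by have [z hz] := (hP _).1 (conv_mem _ xX); exists z => _.
pose V0 x := c - C *m z x.
have V0_ge0 x j : x \in X -> 0 <= V0 x j 0.
  by move=> /hz[h _ _]; rewrite !mxE subr_ge0; have := h j; rewrite mxE.
pose xm j := [arg max_(x > x1 in X) V0 x j 0]%O.
have xmX j : xm j \in X by rewrite /xm; case: arg_maxP.
have xm_max j x : x \in X -> V0 x j 0 <= V0 (xm j) j 0.
  by rewrite /xm; case: arg_maxP => // y _ + xX; apply.
pose nu j := V0 (xm j) j 0.
have nu0 j : 0 <= nu j by exact: V0_ge0.
have V0_0 x j : x \in X -> nu j = 0 -> V0 x j 0 = 0.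
  by move=> xX e; apply/eqP; rewrite eq_le V0_ge0 // andbT -e xm_max.
(* If [nu j = 0] then [V0 x j 0 = 0] on [X], so the division by 0 is harmless. *)
exists (fun x => \col_j (V0 x j 0 / nu j)); split=> [x j xX|a beta B B0 ha [x0 x0X ax0]].
  rewrite mxE divr_ge0 ?V0_ge0 //=.
  have [->|nz] := eqVneq (nu j) 0; first by rewrite invr0 mulr0 ler01.
  by rewrite ler_pdivrMr ?mul1r ?xm_max // lt_neqAle eq_sym nz nu0.
have [Cx0 Dx0 px0] := hz _ x0X.
have [|u [w [u0 ap ub]]] := @farkas_affine _ _ _ _ C c D d (a *m p) beta _ Cx0 Dx0.
  move=> y Cy Dy; have : conv01 X (p *m y) by apply/hP; exists y.
  case=> lam [lam0 lamX lam1 py]; rewrite -mulmxA py mulmx_sumr summxE.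
  rewrite -[beta]mul1r -lam1 mulr_suml; apply: ler_sum => x _.
  rewrite -scalemxAr mxE; have [xX|xX] := boolP (x \in X); last by rewrite lamX ?mul0r.
  by rewrite ler_wpM2l //; have /andP[h _] := ha x xX; rewrite -subr_ge0.
have slackE x : x \in X -> (a *m vec01 R x) 0 0 + (u *m V0 x) 0 0 = (u *m c + w *m d) 0 0.
  move=> /hz[_ Dx ->]; rewrite mulmxA ap mulmxDl -!mulmxA Dx mulmxBr.
  move: (u *m _) (u *m c) (w *m d) => p1 p2 p3; rewrite !mxE; lra.
have ubE : (u *m c + w *m d) 0 0 = beta.
  apply: le_anti; rewrite ub -(slackE x0) // ax0 lerDl mxE.
  by apply: sumr_ge0 => j _; rewrite mulr_ge0 // V0_ge0.
pose u' : 'rV[R]_r := \row_j (u 0 j * nu j).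
have u'V x : x \in X -> (a *m vec01 R x) 0 0 + \sum_j u 0 j * V0 x j 0 = beta.
  by move=> xX; rewrite -ubE -(slackE x xX); congr (_ + _); rewrite mxE.
exists u' => [j|x xX].
  (* The slack of [a] at [xm j] is at most [B] and is a sum of nonnegative terms, one of which is
     [u' 0 j]. *)
  rewrite mxE mulr_ge0 //=; have /andP[_] := ha _ (xmX j); apply: le_trans.
  rewrite -(u'V _ (xmX j)) addrC addKr (bigD1 j) //= lerDl.
  by apply: sumr_ge0 => i _; rewrite mulr_ge0 // V0_ge0.
rewrite mxE [X in _ + X]mxE -(u'V x xX); congr (_ + _); apply: eq_bigr => j _.
rewrite [u' 0 j]mxE [X in _ * X = _]mxE; have [e|nz] := eqVneq (nu j) 0.
  by rewrite e V0_0 // mulr0 mul0r.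
by rewrite -mulrA; congr (_ * _); rewrite mulrC divfK.
Qed.

(** * Hadamard's inequality *)

(** Gram-Schmidt, one row at a time: replacing the first row by its component orthogonal to the
    others keeps the Gram determinant, which then factors, and the component is no longer than the
    row. *)
Lemma hadamard_gram (R : realFieldType) (k m : nat) (B : 'M[R]_(k, m)) :
  0 <= \det (B *m B^T) <= \prod_i \sum_j B i j ^+ 2.
Proof.
elim: k B => [|k IHk] B; first by rewrite det_mx00 big_ord0 ler01 lexx.
rewrite -[B](@vsubmxK _ 1 k); set x := usubmx (B : 'M_(1 + k, m)); set C := dsubmx _.
have /andP[C0 Cle] := IHk C.
have prodE : \prod_(i < k.+1) \sum_j (col_mx x C) i j ^+ 2
     = (\sum_j x 0 j ^+ 2) * \prod_i \sum_j C i j ^+ 2.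
  rewrite big_ord_recl; congr (_ * _).
    by apply: eq_bigr => j _; rewrite (_ : ord0 = @lshift 1 k 0) ?col_mxEu //; apply: val_inj.
  apply: eq_bigr => i _; apply: eq_bigr => j _.
  by rewrite (_ : lift _ _ = @rshift 1 k i) ?col_mxEd //; apply: val_inj.
rewrite prodE.
have normE (y : 'rV[R]_m) : (y *m y^T) 0 0 = \sum_j y 0 j ^+ 2.
  by rewrite mxE; apply: eq_bigr => j _; rewrite mxE.
have norm_ge0 (y : 'rV[R]_m) : 0 <= \sum_j y 0 j ^+ 2 by apply: sumr_ge0 => j _; rewrite sqr_ge0.
have prod_ge0 : 0 <= \prod_i \sum_j C i j ^+ 2.
  by apply: prodr_ge0 => i _; apply: sumr_ge0 => j _; rewrite sqr_ge0.
have [CU|CnU] := boolP (C *m C^T \in unitmx); last first.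
  have : ~~ row_free (C *m C^T) by rewrite row_free_unit.
  rewrite -kermx_eq0 => /rowV0Pn[u /sub_kermxP uC u0].
  have uC0 : u *m C = 0.
    have : ((u *m C) *m (u *m C)^T) 0 0 = 0.
      by rewrite trmx_mul mulmxA -[_ *m C *m _]mulmxA uC mul0mx mxE.
    rewrite normE => /eqP; rewrite psumr_eq0 => [/allP h|j _]; last exact: sqr_ge0.
    apply/rowP => j; rewrite [RHS]mxE; apply/eqP.
    by have := h j (mem_index_enum _); rewrite sqrf_eq0.
  have -> : \det (col_mx x C *m (col_mx x C)^T) = 0.
    apply/eqP/det0P; exists (row_mx 0 u).
      by rewrite (@row_mx_eq0 _ 1 1 k) eqxx.
    by rewrite mulmxA (@mul_row_col _ _ 1) mul0mx add0r uC0 mul0mx.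
  by rewrite lexx mulr_ge0.
(* [y] is the orthogonal projection of [x] on the row space of [C]. *)
pose y := x *m C^T *m invmx (C *m C^T) *m C; pose z := x - y.
have zC : z *m C^T = 0.
  by rewrite mulmxBl -mulmxA mulmxKV ?subrr.
have Cz : C *m z^T = 0 by rewrite -[LHS]trmxK trmx_mul trmxK zC trmx0.
have zy : z *m y^T = 0 by rewrite /y trmx_mul mulmxA zC mul0mx.
have xzy : x = z + y by rewrite subrK.
pose L : 'M[R]_(1 + k) := block_mx 1%:M (x *m C^T *m invmx (C *m C^T)) 0 1%:M.
have LE : col_mx x C = L *m col_mx z C.
  by rewrite mul_block_col !mul1mx mul0mx add0r -/y -xzy.
have -> : \det (col_mx x C *m (col_mx x C)^T) = (\sum_j z 0 j ^+ 2) * \det (C *m C^T).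
  rewrite LE trmx_mul mulmxA -[L *m _ *m _]mulmxA !det_mulmx det_tr.
  rewrite (@det_ublock _ 1 k) !det1 !mul1r mulr1 tr_col_mx mul_col_row Cz zC.
  by rewrite (@det_ublock _ 1 k) det_mx11 normE.
rewrite mulr_ge0 //=; apply: ler_pM => //.
have yz : y *m z^T = 0 by rewrite -[LHS]trmxK trmx_mul trmxK zy trmx0.
have -> : \sum_j x 0 j ^+ 2 = \sum_j z 0 j ^+ 2 + \sum_j y 0 j ^+ 2.
  by rewrite -!normE xzy linearD /= mulmxDl !mulmxDr zy yz addr0 add0r mxE.
by rewrite lerDl.
Qed.

Lemma hadamard (R : rcfType) (N : nat) (B : 'M[R]_N) :
  (forall i j, `|B i j| <= 1) -> `|\det B| <= Num.sqrt N%:R ^+ N.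
Proof.
move=> B1; rewrite -ler_sqr ?nnegrE ?normr_ge0 ?exprn_ge0 ?sqrtr_ge0 //.
rewrite real_normK ?num_real // exprAC sqr_sqrtr ?ler0n //.
have /andP[_] := hadamard_gram B; rewrite det_mulmx det_tr -expr2 => /le_trans; apply.
rewrite -[X in _ ^+ X]card_ord -prodr_const; apply: ler_prod => i _.
rewrite sumr_ge0 => [|j _]; last exact: sqr_ge0.
apply: (@le_trans _ _ (\sum_(j < N) 1)); last by rewrite sumr_const card_ord.
apply: ler_sum => j _.
by rewrite -real_normK ?num_real // exprn_ile1.
Qed.

(** * Selection of rows of maximal volume *)

Lemma exists_det_neq0 (F : fieldType) (T : finType) (N : nat) (H : T -> 'rV[F]_N) :
  (forall d : 'cV[F]_N, (forall t, H t *m d = 0) -> d = 0) ->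
  exists f : {ffun 'I_N -> T}, \det (\matrix_i H (f i)) != 0.
Proof.
move=> span; pose M := \matrix_(i < #|T|) H (enum_val i).
have Mfull : row_full M.
  rewrite /row_full -mxrank_tr -/(row_free M^T) -kermx_eq0; apply/rowV0P => u /sub_kermxP uM.
  apply: trmx_inj; rewrite trmx0; apply: span => t.
  have := congr1 (fun A => row (enum_rank t) A^T) uM.
  by rewrite trmx_mul trmxK row_mul rowK enum_rankK trmx0 row0.
exists [ffun i => enum_val (fullrankfun Mfull i)].
have := fullrowsub_full Mfull; rewrite row_full_unit unitmxE unitfE.
by rewrite (_ : rowsub _ M = \matrix_i H ([ffun i => enum_val (fullrankfun Mfull i)] i)) //;
   apply/matrixP => i j; rewrite !mxE ffunE.
Qed.

Definition replace_row (S : Type) (N : nat) (k : 'I_N) (w : 'rV[S]_N) (B : 'M[S]_N) :=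
  \matrix_(i, j) if i == k then w 0 j else B i j.

(** Serves twice: for Cramer's rule in [max_volume_rows], and to turn values of a cofactor vector
    into determinants in [integral_saturated]. *)
Lemma det_replace_row (S : comNzRingType) (N : nat) (k : 'I_N) (w : 'rV[S]_N) (B : 'M[S]_N) :
  \det (replace_row k w B) = \sum_j w 0 j * cofactor B k j.
Proof.
rewrite (expand_det_row _ k); apply: eq_bigr => j _; rewrite mxE eqxx; congr (_ * _).
rewrite /cofactor; congr (_ * \det _); apply/matrixP => i l.
by rewrite !mxE eq_sym (negPf (neq_lift _ _)).
Qed.

(** Choose [N] rows with the largest absolute determinant. By Cramer's rule each coefficient is the
    determinant after exchanging one row, divided by the maximal one. *)
Lemma max_volume_rows (R : realFieldType) (T : finType) (N : nat) (H : T -> 'rV[R]_N) :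
  (forall d : 'cV[R]_N, (forall t, H t *m d = 0) -> d = 0) ->
  exists (f : 'I_N -> T) (lam : T -> 'rV[R]_N),
    (forall t j, `|lam t 0 j| <= 1) /\ forall t, H t = \sum_j lam t 0 j *: H (f j).
Proof.
move=> /exists_det_neq0[f0 f0P].
pose B (f : {ffun 'I_N -> T}) := \matrix_i H (f i).
pose f := [arg max_(f > f0) `|\det (B f)|]%O.
have fmax g : `|\det (B g)| <= `|\det (B f)|.
  by rewrite /f; case: arg_maxP => // h _; apply.
have Bf_gt0 : 0 < `|\det (B f)| by apply: lt_le_trans (fmax f0); rewrite normr_gt0.
have Bf0 : \det (B f) != 0 by rewrite -normr_gt0.
have BfU : B f \in unitmx by rewrite unitmxE unitfE.
exists f, (fun t => H t *m invmx (B f)); split=> [t j|t].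
  have -> : (H t *m invmx (B f)) 0 j = \det (replace_row j (H t) (B f)) / \det (B f).
    rewrite /invmx BfU -scalemxAr mxE mulrC mxE det_replace_row; congr (_ / _).
    by apply: eq_bigr => i _; rewrite [\adj _ _ _]mxE.
  rewrite normrM normfV ler_pdivrMr // mul1r.
  apply: le_trans (fmax [ffun i => if i == j then t else f i]).
  rewrite le_eqVlt; apply/orP; left; apply/eqP; congr `|\det _|.
  by apply/matrixP => i l; rewrite !mxE ffunE; case: eqP => _ //; rewrite mxE.
rewrite -[LHS](mulmxKV BfU) [LHS]mulmx_sum_row; apply: eq_bigr => j _.
by rewrite rowK.
Qed.

(** The family may be rank deficient, so [max_volume_rows] is applied to the coordinates [H'] in a
    row basis; linear relations carry back to [H]. *)
Lemma bounded_row_generators (R : realFieldType) (T : finType) (t0 : T) (k : nat)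
    (H : T -> 'rV[R]_k) :
  exists (f : 'I_k -> T) (lam : T -> 'rV[R]_k),
    (forall t j, `|lam t 0 j| <= 1) /\ forall t, H t = \sum_j lam t 0 j *: H (f j).
Proof.
pose M := \matrix_(i < #|T|) H (enum_val i).
have HM t : H t = row (enum_rank t) M by rewrite rowK enum_rankK.
pose H' t := row (enum_rank t) (col_base M).
have HH' t : H t = H' t *m row_base M by rewrite HM -row_mul mulmx_base.
have [|f [lam [lam1 lamE]]] := @max_volume_rows _ T _ H'.
  move=> d hd; have CB : row_full (col_base M) by exact: col_base_full.
  have [L LC] := row_fullP CB.
  rewrite -[d]mul1mx -LC -mulmxA (_ : col_base M *m d = 0) ?mulmx0 //.
  apply/row_matrixP => i; rewrite row_mul row0 -(hd (enum_val i)).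
  by rewrite /H' enum_valK.
have le_rk : (\rank M <= k)%N by exact: rank_leq_col.
(* Beyond the rank, [f] is padded with the dummy [t0], used with coefficient 0. *)
exists (fun i => oapp f t0 (insub (val i))).
exists (fun t => \row_(i < k) oapp (lam t 0) 0 (insub (val i))); split=> [t j|t].
  by rewrite mxE; case: insubP => [i _ _|_] /=; rewrite ?normr0 ?ler01.
pose G t i := oapp (lam t 0) 0 (insub i) *: H (oapp f t0 (insub i)) : 'rV[R]_k.
have GE i (hi : (i < \rank M)%N) : insub i = Some (Ordinal hi) by rewrite insubT.
transitivity (\sum_(i < k) G t i); last by apply: eq_bigr => i _; rewrite mxE.
rewrite (bigID (fun i : 'I_k => (i < \rank M)%N)) /= [X in _ + X]big1 ?addr0; last first.
  by move=> i hi; rewrite /G insubN //= scale0r.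
rewrite -(big_ord_widen k (G t) le_rk) HH' lamE mulmx_suml.
by apply: eq_bigr => j _; rewrite /G valK /= -scalemxAl -HH'.
Qed.

(** * Integral functionals with maximal tight sets *)

(* Maximizing the set of annihilated [G t] makes [c'] the only solution of its tight system. *)
Lemma exists_saturated (R : realFieldType) (T : finType) (W : pred T) (N : nat)
    (G : T -> 'rV[R]_N) (h : 'rV[R]_N) (c : 'cV[R]_N) :
  (forall d : 'cV[R]_N, (forall t, G t *m d = 0) -> d = 0) ->
  (forall t, W t -> (G t *m c) 0 0 <= 0) -> (h *m c) 0 0 = 1 ->
  exists c' : 'cV[R]_N,
    [/\ forall t, W t -> (G t *m c') 0 0 <= 0, (h *m c') 0 0 = 1,
        forall t, (G t *m c) 0 0 = 0 -> (G t *m c') 0 0 = 0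
      & forall d : 'cV[R]_N, (forall t, (G t *m c') 0 0 = 0 -> (G t *m d) 0 0 = 0) ->
          (h *m d) 0 0 = 0 -> d = 0].
Proof.
move=> span.
pose nz (c : 'cV[R]_N) := #|[pred t | (G t *m c) 0 0 != 0]|.
have [m] := ubnP (nz c); elim: m c => // m IHm c; rewrite ltnS => nzc cW hc.
have [hd|] := pselect (forall d : 'cV[R]_N,
    (forall t, (G t *m c) 0 0 = 0 -> (G t *m d) 0 0 = 0) -> (h *m d) 0 0 = 0 -> d = 0).
  by exists c.
move=> /existsNP[d /not_implyP[dZ /not_implyP[hd /eqP d0]]].
(* Moving along [d] keeps tight rows tight and the value at [h] equal to 1; what remains is a step
   that makes one more row tight and respects [W]. *)
suff [s [t [cd sW Gtc Gtd]]] : exists s t, [/\ (G t *m (c + s *: d)) 0 0 = 0,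
    forall t, W t -> (G t *m (c + s *: d)) 0 0 <= 0, (G t *m c) 0 0 != 0
    & (G t *m d) 0 0 != 0].
  have cZ u : (G u *m c) 0 0 = 0 -> (G u *m (c + s *: d)) 0 0 = 0.
    by move=> e; rewrite mulmxDr -scalemxAr mxE [X in _ + X]mxE e dZ // mulr0 addr0.
  have [|||c' [cW' hc' cZ' cd']] := IHm (c + s *: d) => //.
  - apply: leq_trans nzc; apply: proper_card; apply/properP; split.
      by apply/subsetP => u; rewrite !inE; apply: contra_neq; exact: cZ.
    by exists t; rewrite inE // cd eqxx.
  - by rewrite mulmxDr -scalemxAr mxE [X in _ + X]mxE hd mulr0 addr0.
  exists c'; split=> // u hu; exact/cZ'/cZ.
have Gnz t : (G t *m d) 0 0 != 0 -> (G t *m c) 0 0 != 0 by apply: contra_neq; exact: dZ.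
have [/existsP[t0 /andP[t0W t0d]]|noW] := boolP [exists t, W t && ((G t *m d) 0 0 != 0)].
  wlog dpos : d {d0} dZ hd Gnz t0d / 0 < (G t0 *m d) 0 0.
    move=> wl; have [|dn|e] := ltgtP 0 ((G t0 *m d) 0 0); first exact: wl.
      have Nd u : (G u *m (- d)) 0 0 = - (G u *m d) 0 0 by rewrite mulmxN mxE.
      have [||u|||s [t [h1 h2 h3 h4]]] := wl (- d).
      - by move=> u /dZ; rewrite Nd => ->; rewrite oppr0.
      - by rewrite mulmxN mxE hd oppr0.
      - by rewrite Nd oppr_eq0; exact: Gnz.
      - by rewrite Nd oppr_eq0.
      - by rewrite Nd oppr_gt0.
      exists (- s), t; split=> // [|u uW|]; last by rewrite Nd oppr_eq0 in h4.
        by rewrite scaleNr -scalerN.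
      by rewrite scaleNr -scalerN; exact: h2.
    by rewrite -e eqxx in t0d.
  pose P t := W t && (0 < (G t *m d) 0 0).
  (* Ratio test: the minimizer is the first inequality of [W] to become tight along [d]. *)
  pose q t := - (G t *m c) 0 0 / (G t *m d) 0 0.
  have Pt0 : P t0 by rewrite /P t0W.
  pose t := [arg min_(t < t0 | P t) q t]%O.
  have [Pt tmin] : P t /\ forall u, P u -> q t <= q u.
    by rewrite /t; case: arg_minP => // u Pu hu; split.
  have /andP[tW td] := Pt; exists (q t), t.
  have td0 : (G t *m d) 0 0 != 0 by rewrite gt_eqF.
  split=> [|u uW||//]; last exact: Gnz.
    by rewrite mulmxDr -scalemxAr mxE [X in _ + X]mxE divfK // subrr.
  rewrite mulmxDr -scalemxAr mxE [X in _ + X]mxE.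
  have qt0 : 0 <= q t by apply: divr_ge0; [rewrite oppr_ge0 cW | exact: ltW].
  have [ud|ud] := ltP 0 ((G u *m d) 0 0); last first.
    by rewrite -[leRHS]addr0 lerD ?cW // mulr_ge0_le0.
  by rewrite -lerBrDl sub0r -ler_pdivlMr // tmin // /P uW.
(* In this case [d] is invisible to [W], so any step length is allowed; [span] supplies a row on
   which [d] is nonzero. *)
have dW t : W t -> (G t *m d) 0 0 = 0.
  by move=> tW; apply/eqP; move: noW => /existsPn/(_ t); rewrite tW /= negbK.
have /existsNP[t /eqP td] : ~ forall t, G t *m d = 0.
  by move=> e; move/eqP: d0; apply; exact: span.
have {}td : (G t *m d) 0 0 != 0.
  by apply: contra_neq td => e; rewrite [LHS]mx11_scalar e raddf0.
exists (- (G t *m c) 0 0 / (G t *m d) 0 0), t; split=> // [|u uW|]; last exact: Gnz.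
  by rewrite mulmxDr -scalemxAr mxE [X in _ + X]mxE divfK // subrr.
by rewrite mulmxDr -scalemxAr mxE [X in _ + X]mxE (dW u) // mulr0 addr0 cW.
Qed.

Definition is01 (N : nat) (w : 'rV[int]_N) := forall j, (w 0 j == 0) || (w 0 j == 1).

(** A saturated solution is determined by a nonsingular 0/1 matrix [B] made of [h] and tight rows,
    hence proportional to the integer cofactors along the row [h]. Pairing these with a 0/1 row
    gives the determinant of a 0/1 matrix, to which [hadamard] applies. *)
Lemma integral_saturated (R : rcfType) (N : nat) (T : finType) (W : pred T)
    (G : T -> 'rV[int]_N) (h : 'rV[int]_N) (c : 'cV[R]_N) :
  (forall t, is01 (G t)) -> is01 h ->
  (forall d : 'cV[R]_N, (forall t, map_mx intr (G t) *m d = 0) -> d = 0) ->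
  (forall t, W t -> (map_mx intr (G t) *m c) 0 0 <= 0) -> (map_mx intr h *m c) 0 0 = 1 ->
  exists c' : 'cV[int]_N,
    [/\ forall t, W t -> (G t *m c') 0 0 <= 0, 0 < (h *m c') 0 0,
        forall t, (map_mx intr (G t) *m c) 0 0 = 0 -> (G t *m c') 0 0 = 0
      & forall w, is01 w -> `|((w *m c') 0 0)%:~R| <= (Num.sqrt N%:R ^+ N : R)].
Proof.
move=> G01 h01 span cW hc.
have [{}c0 [c0W hc0 c0Z c0s]] := exists_saturated span cW hc.
pose Z t := (map_mx intr (G t) *m c0) 0 0 == 0.
pose H (o : option T) : 'rV[int]_N :=
  if o is Some t then if Z t then G t else 0 else h.
have H01 o : is01 (H o).
  by case: o => [t|//]; rewrite /H; case: ifP => // _ j; rewrite mxE eqxx.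
have [|f] := @exists_det_neq0 R _ _ (fun o => map_mx intr (H o)).
  move=> d hd; apply: c0s => [t /eqP tZ|].
    by have := hd (Some t); rewrite /H /Z tZ => ->; rewrite mxE.
  by have := hd None; rewrite /H => ->; rewrite mxE.
pose B : 'M[int]_N := \matrix_i H (f i).
have -> : \matrix_i map_mx intr (H (f i)) = map_mx intr B :> 'M[R]_N.
  by apply/matrixP => i j; rewrite !mxE.
rewrite det_map_mx intr_eq0 => B0.
have Bc0 i : (map_mx intr B *m c0) i 0 = (f i == None)%:R.
  have -> : (map_mx intr B *m c0) i 0 = (map_mx intr (H (f i)) *m c0) 0 0.
    by rewrite !mxE; apply: eq_bigr => j _; rewrite !mxE.
  case: (f i) => [t|] //=; case: ifP => [/eqP -> //|_].
  by rewrite map_mx0 mul0mx mxE.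
have BU : (map_mx intr B : 'M[R]_N) \in unitmx.
  by rewrite unitmxE unitfE det_map_mx intr_eq0.
(* The row [h] must occur in [B], since otherwise [B *m c0 = 0] would force [c0 = 0]; by [funiq] it
   occurs only once, so [B *m c0] is a unit vector. *)
have [k /eqP fk] : exists k, f k == None.
  apply/existsP; apply: contraT => /existsPn hf.
  have B0' : map_mx intr B *m c0 = 0 by apply/colP => i; rewrite Bc0 (negPf (hf i)) mxE.
  have c00 : c0 = 0 by rewrite -(mulKmx BU c0) B0' mulmx0.
  by move/eqP: hc0; rewrite c00 mulmx0 mxE eq_sym oner_eq0.
pose c1 : 'cV[int]_N := \col_j cofactor B k j.
have wc1 w : (w *m c1) 0 0 = \det (replace_row k w B).
  by rewrite det_replace_row mxE; apply: eq_bigr => j _; rewrite !mxE.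
have c1E : B *m c1 = \det B *: delta_mx k 0.
  have -> : c1 = col k (\adj B) by apply/colP => j; rewrite !mxE.
  by rewrite colE mulmxA mul_mx_adj mul_scalar_mx.
have funiq i : i != k -> f i != None.
  move=> ik; apply/eqP => fi; move/negP: B0; apply; apply/eqP.
  by apply: (determinant_alternate ik) => j; rewrite !mxE fi fk.
have c1c0 : map_mx intr c1 = (\det B)%:~R *: c0.
  apply: (can_inj (mulKmx BU)); rewrite -map_mxM c1E -scalemxAr.
  apply/colP => i; rewrite [RHS]mxE Bc0 !mxE eqxx andbT rmorphM /=; congr (_ * _).
  by have [->|ik] := eqVneq i k; rewrite ?fk //= (negPf (funiq i ik)).
have c1R w : ((w *m c1) 0 0)%:~R = (\det B)%:~R * (map_mx intr w *m c0) 0 0 :> R.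
  have -> : ((w *m c1) 0 0)%:~R = (map_mx intr w *m map_mx intr c1) 0 0 :> R.
    by rewrite -map_mxM [RHS]mxE.
  by rewrite c1c0 -scalemxAr mxE.
(* The sign makes this a positive multiple of [c0], so inequalities keep their direction. *)
exists (Num.sg (\det B) *: c1).
have scE w : (w *m (Num.sg (\det B) *: c1)) 0 0 = Num.sg (\det B) * (w *m c1) 0 0.
  by rewrite -scalemxAr mxE.
have scR w : ((w *m (Num.sg (\det B) *: c1)) 0 0)%:~R
    = `|\det B|%:~R * (map_mx intr w *m c0) 0 0 :> R.
  by rewrite scE intrM c1R mulrA -intrM -normrEsg.
have dB_gt0 : 0 < `|\det B|%:~R :> R by rewrite ltr0z normr_gt0.
split=> [t tW||t tZ|w w01].
- by rewrite -(lerz0 R) scR pmulr_rle0 ?c0W.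
- by rewrite -(ltr0z R) scR hc0 mulr1.
- by apply/eqP; rewrite -(intr_eq0 R) scR c0Z ?mulr0.
rewrite scE intrM normrM -!intr_norm normr_sg B0 mul1r intr_norm wc1 -det_map_mx.
apply: hadamard => i j; rewrite mxE.
have /orP[] : (replace_row k w B i j == 0) || (replace_row k w B i j == 1).
  by rewrite !mxE; case: (i == k); [exact: (w01 j) | exact: (H01 _ j)].
all: by move=> /eqP ->; rewrite ?normr0 ?ler01 ?normr1.
Qed.

(** * Separation of a cube vertex from [X] *)

(** In homogeneous coordinates [hat x = (1, x)], a functional built from the Hamming distance to [v]
    is the starting point for [integral_saturated]; the dimension [n + 1] accounts for [Delta]. *)
Lemma cube_separation (R : realType) (n : nat) (X : {set {ffun 'I_n -> bool}}) v :
  let Delta : R := Num.sqrt ((n.+1)%:R) ^+ n.+1 in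
  X != set0 -> v \notin X ->
  exists (a : 'rV[int]_n) (beta : int),
    [/\ forall j, `|(a 0 j)%:~R| <= Delta, `|beta%:~R| <= Delta,
        forall x, x \in X -> 0 <= beta%:~R - (map_mx intr a *m vec01 R x) 0 0 <= Delta,
        exists2 x, x \in X & (map_mx intr a *m vec01 R x) 0 0 = beta%:~R
      & beta%:~R + 1 <= (map_mx intr a *m vec01 R v) 0 0].
Proof.
move=> Delta /set0Pn[x1 x1X] vX.
pose hat (x : {ffun 'I_n -> bool}) : 'rV[int]_(1 + n) := row_mx 1%:M (\row_j (x j)%:R).
have hat01 x : is01 (hat x).
  move=> j; case: (split_ordP j) => i ->; rewrite (row_mxEl, row_mxEr) mxE.
    by rewrite !ord1 eqxx orbT.
  by case: (x i).
(* Points of [X] give the inequalities; unit vectors make the family spanning and may become tight,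
   but impose no sign. *)
pose G (t : {ffun 'I_n -> bool} + 'I_(1 + n)) : 'rV[int]_(1 + n) :=
  match t with inl x => if x \in X then hat x else 0 | inr j => delta_mx 0 j end.
have G01 t : is01 (G t).
  case: t => [x|i] /=; first by case: ifP => // _ j; rewrite mxE eqxx.
  by move=> j; rewrite mxE; case: (_ && _).
pose dist (x : {ffun 'I_n -> bool}) := (\sum_i (x i != v i))%N.
pose w0 := [arg min_(x < x1 in X) dist x].
have [w0X w0min] : w0 \in X /\ forall x, x \in X -> (dist w0 <= dist x)%N.
  by rewrite /w0; case: arg_minnP.
have dist0 : (0 < dist w0)%N.
  rewrite lt0n sum_nat_eq0; apply: contraNN vX => /forallP h.
  suff -> : v = w0 by [].
  by apply/ffunP => i; have := h i; rewrite /= eqb0 negbK => /eqP.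
pose d0 : R := (dist w0)%:R.
have d0_gt0 : 0 < d0 by rewrite ltr0n.
(* The functional [1 - dist x / dist w0]: it is 1 at [v], at most 0 on [X], and 0 at the nearest
   point [w0], which therefore stays tight. *)
pose c : 'cV[R]_(1 + n) :=
  col_mx (1 - (\sum_i (v i)%:R) / d0)%:M (\col_i (((v i)%:R *+ 2 - 1) / d0)).
have hatc x : (map_mx intr (hat x) *m c) 0 0 = 1 - (dist x)%:R / d0.
  rewrite map_row_mx map_scalar_mx mul_row_col mul_scalar_mx scale1r mxE.
  rewrite [_%:M _ _]mxE eqxx mulr1n mxE -addrA; congr (_ + _).
  rewrite natr_sum !mulr_suml -!sumrN -big_split /=; apply: eq_bigr => i _.
  by rewrite !mxE; case: (v i); case: (x i) => /=; rewrite ?mulr1z ?mulr0z; ring.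
pose W (t : {ffun 'I_n -> bool} + 'I_(1 + n)) := if t is inl _ then true else false.
have [|t||c' [c'W c'v c'Z c'b]] := @integral_saturated R _ _ W G (hat v) c G01 (hat01 v).
- move=> d hd; apply/colP => j; have := hd (inr j).
  by rewrite /= map_delta_mx -rowE => /rowP/(_ 0); rewrite !mxE.
- case: t => //= x _; case: ifP => [xX|_]; last by rewrite map_mx0 mul0mx mxE.
  by rewrite hatc subr_le0 ler_pdivlMr // mul1r ler_nat w0min.
- rewrite hatc (_ : dist v = 0%N) ?mul0r ?subr0 //.
  by rewrite /dist big1 // => i _; rewrite eqxx.
pose a : 'rV[int]_n := (dsubmx c')^T; pose beta : int := - (usubmx c') 0 0.
have hatE x : (map_mx intr a *m vec01 R x) 0 0 - beta%:~R = ((hat x *m c') 0 0)%:~R.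
  rewrite -[c' in RHS]vsubmxK mul_row_col mul1mx [in RHS]mxE intrD /beta mulrNz opprK addrC.
  congr (_ + _); rewrite !mxE rmorph_sum; apply: eq_bigr => j _.
  by rewrite !mxE mulrC rmorphM /=; case: (x j); rewrite ?mulr1z ?mulr0z.
exists a, beta; split.
(* Unit vectors are 0/1 rows, so the bound on pairings also bounds the coefficients. *)
- move=> j; have := c'b (delta_mx 0 (rshift 1 j)).
  rewrite -rowE !mxE; apply=> i; rewrite mxE.
  by case: (_ && _).
- have := c'b (delta_mx 0 (lshift n 0)).
  rewrite -rowE /beta mulrNz normrN !mxE; apply=> i; rewrite mxE.
  by case: (_ && _).
- move=> x xX; rewrite -opprB hatE oppr_ge0 lerz0.
  have := c'W (inl x) isT; rewrite /G xX => -> /=.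
  by apply: le_trans (c'b _ (hat01 x)); rewrite -normrN ler_norm.
- exists w0 => //; apply/eqP; rewrite -subr_eq0 hatE intr_eq0; apply/eqP.
  have := c'Z (inl w0); rewrite /G w0X; apply.
  by rewrite hatc divff ?subrr // gt_eqF.
by rewrite addrC -lerBrDr hatE ler1z -gtz0_ge1.
Qed.

(** * Assembly of the system and rounding *)

Theorem theorem3 (R : realType) (n : nat) (X : {set {ffun 'I_n -> bool}})
  (r : nat) :
  (0 < n)%N -> X != set0 -> is_xc (@conv01 R n X) r ->
  let Delta : R := Num.sqrt ((n.+1)%:R) ^+ n.+1 in
  exists (A : 'M[int]_(n + r, n)) (U : 'M[R]_(n + r, r)) (b : 'cV[int]_(n + r)),
    [/\ forall i j, `|(A i j)%:~R| <= Delta,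
        forall i, `|(b i 0)%:~R| <= Delta,
        forall i j, `|U i j| <= Delta,
        forall i j, exists k : nat,
          U i j = k%:R / (4 * r%:R * (n + r)%:R * Delta)
      & forall v : {ffun 'I_n -> bool},
          v \in X <->
          exists y : 'cV[R]_r,
            (forall j, 0 <= y j 0 <= Delta) /\
            forall i, `|(map_mx intr A *m @vec01 R n v + U *m y - map_mx intr b) i 0|
                      <= 1 / (4 * (n + r)%:R)].
Proof.
move=> n0 X0 [/(slack_factorization X0)[V [V01 Vfact]] _] Delta.
have Delta1 : 1 <= Delta by rewrite exprn_ege1 // -[leLHS]sqrtr1 ler_wsqrtr // ler1n.
have Delta0 : 0 < Delta by exact: lt_le_trans ltr01 Delta1.
have nr0 : 0 < (n + r)%:R :> R by rewrite ltr0n addn_gt0 n0.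
have /choice[F hF] : forall v, exists q : 'rV[int]_n * int * 'rV[R]_r,
    [/\ (forall j, `|(q.1.1 0 j)%:~R| <= Delta) /\ `|q.1.2%:~R| <= Delta,
        forall j, 0 <= q.2 0 j <= Delta,
        forall x, x \in X -> (map_mx intr q.1.1 *m vec01 R x + q.2 *m V x) 0 0 = q.1.2%:~R
      & v \notin X -> q.1.2%:~R + 1 <= (map_mx intr q.1.1 *m vec01 R v) 0 0].
  move=> v; have [vX|vX] := boolP (v \in X).
    exists (0, 0, 0); split=> // [|j|x xX] /=.
    - by split=> [j|]; rewrite ?mxE mulr0z normr0 ltW.
    - by rewrite mxE lexx ltW.
    - by rewrite map_mx0 !mul0mx addr0 mxE.
  have [a [beta [aD bD slack tight sep]]] := cube_separation R X0 vX.
  have [u uD hu] := Vfact _ _ _ (ltW Delta0) slack tight.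
  by exists (a, beta, u); split.
pose a v := (F v).1.1; pose beta v := (F v).1.2; pose u v := (F v).2.
have /set0Pn[x0 x0X] := X0.
pose res v (z : 'cV[R]_(n + r)) := (row_mx (map_mx intr (a v)) (u v) *m z) 0 0 - (beta v)%:~R.
have [f [lam [lam1 lamE]]] :=
  bounded_row_generators x0 (fun v => row_mx (map_mx intr (a v)) (u v)).
(* The right-hand sides are not part of the rows, but all equations hold at the common point [z0],
   so residuals are linear in [z - z0] and inherit the coefficients [lam]. *)
have resE v z : res v z = \sum_j lam v 0 j * res (f j) z.
  pose z0 := col_mx (vec01 R x0) (V x0).
  have resE0 w : res w z = (row_mx (map_mx intr (a w)) (u w) *m (z - z0)) 0 0.
    have [_ _ h _] := hF w; rewrite /res /beta -(h x0 x0X) mulmxBr /z0 mul_row_col.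
    by rewrite [RHS]mxE [X in _ = _ + X]mxE.
  rewrite resE0 lamE mulmx_suml summxE; apply: eq_bigr => j _.
  by rewrite resE0 -scalemxAl mxE.
pose K : R := 4 * r%:R * (n + r)%:R * Delta.
(* For [r = 0] the constant [K] is 0; a column index rules this out. *)
have K_gt0 : 'I_r -> 0 < K.
  by move=> j; rewrite !mulr_gt0 // ltr0n (leq_ltn_trans (leq0n j)).
pose U : 'M[R]_(n + r, r) := \matrix_(i, j) ((Num.truncn (K * u (f i) 0 j))%:R / K).
have UP i j : 0 <= U i j <= u (f i) 0 j /\ u (f i) 0 j - U i j <= K^-1.
  have K0 := K_gt0 j; have [_ /(_ j)/andP[uf0 _] _ _] := hF (f i).
  have /truncn_itv/andP[h1 h2] : 0 <= K * u (f i) 0 j by rewrite mulr_ge0 // ltW.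
  rewrite mxE divr_ge0 ?ler0n ?(ltW K0) //=; split.
    by rewrite ler_pdivrMr // [leRHS]mulrC.
  rewrite -[leRHS]mul1r lerBlDr -mulrDl ler_pdivlMr // [leLHS]mulrC addrC natr1.
  exact: ltW.
exists (\matrix_(i, j) a (f i) 0 j), U, (\col_i beta (f i)); split.
- by move=> i j; rewrite mxE; have [[]] := hF (f i).
- by move=> i; rewrite mxE; have [[]] := hF (f i).
- move=> i j; have [/andP[U0 Uu] _] := UP i j; rewrite ger0_norm //.
  by have [_ /(_ j)/andP[_ ?] _ _] := hF (f i); exact: le_trans Uu _.
- by move=> i j; exists (Num.truncn (K * u (f i) 0 j)); rewrite mxE.
move=> v; set eps : R := 1 / _; set M := map_mx _ _.
(* Rounding costs at most [Delta / K = eps / r] in each of the [r] columns, hence at most [eps] per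
   residual. *)
have entryE (y : 'cV[R]_r) i : (forall j, 0 <= y j 0 <= Delta) ->
    `|res (f i) (col_mx (vec01 R v) y)
       - (M *m vec01 R v + U *m y - map_mx intr (\col_i beta (f i))) i 0| <= eps.
  move=> y01.
  have -> : res (f i) (col_mx (vec01 R v) y)
      - (M *m vec01 R v + U *m y - map_mx intr (\col_i beta (f i))) i 0
      = \sum_j (u (f i) 0 j - U i j) * y j 0.
    rewrite /res mul_row_col.
    have -> : (map_mx intr (a (f i)) *m vec01 R v + u (f i) *m y) 0 0
      = (M *m vec01 R v) i 0 + \sum_j u (f i) 0 j * y j 0.
      by rewrite !mxE; congr (_ + _); apply: eq_bigr => j _; rewrite !mxE.
    under [RHS]eq_bigr do rewrite mulrBl.
    rewrite sumrB; have -> : \sum_j U i j * y j 0 = (U *m y) i 0 by rewrite mxE.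
    move: (\sum_j _) (M *m _) (U *m y) => s1 s2 s3.
    by rewrite !mxE; ring.
  apply: le_trans (ler_norm_sum _ _ _) _.
  apply: (@le_trans _ _ (\sum_(j < r) (eps / r%:R))).
    apply: ler_sum => j _; have [/andP[U0 Uu] Ud] := UP i j; have /andP[y0 yD] := y01 j.
    have r0 : 0 < r%:R :> R by rewrite ltr0n (leq_ltn_trans (leq0n j)).
    rewrite ger0_norm ?mulr_ge0 ?subr_ge0 //.
    have -> : eps / r%:R = K^-1 * Delta.
      rewrite /eps /K; move: (n + r)%:R nr0 r%:R r0 => p p0 q q0.
      by field; rewrite !gt_eqF.
    by rewrite ler_pM ?subr_ge0.
  rewrite sumr_const card_ord -(mulr_natr (eps / _)); have [->|rn0] := eqVneq r 0%N.
    by rewrite mulr0 divr_ge0 ?mulr_ge0 ?ler0n.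
  by rewrite divfK // pnatr_eq0.
split=> [vX|[y [yD hy]]].
  have VD j : 0 <= V v j 0 <= Delta.
    by have /andP[-> h] := V01 v j vX; exact: le_trans h Delta1.
  exists (V v); split=> // i; rewrite -normrN -[- _]add0r.
  suff <- : res (f i) (col_mx (vec01 R v) (V v)) = 0 by exact: entryE.
  by have [_ _ h _] := hF (f i); rewrite /res mul_row_col h // subrr.
(* As [u v] and [y] are nonnegative, the exact residual of row [v] is at least 1; as a combination
   of [n + r] residuals of size at most [2 eps] it is at most 1/2. *)
apply: contraT => vX; have [_ u0 _ /(_ vX) sep] := hF v.
have : 1 <= res v (col_mx (vec01 R v) y).
  have uy : 0 <= (u v *m y) 0 0.
    rewrite mxE sumr_ge0 // => j _.
    by have /andP[? _] := u0 j; have /andP[? _] := yD j; rewrite mulr_ge0.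
  rewrite /res mul_row_col [X in X - _]mxE; by rewrite addrAC -[leLHS]addr0 lerD // lerBrDl.
rewrite leNgt => /negP; case; rewrite resE.
apply: le_lt_trans (ler_norm _) _; apply: le_lt_trans (ler_norm_sum _ _ _) _.
apply: (@le_lt_trans _ _ (\sum_(j < n + r) (eps + eps))).
  apply: ler_sum => j _; rewrite normrM -[leRHS]mul1r ler_pM //.
  rewrite -[X in `|X|](subrK ((M *m vec01 R v + U *m y - map_mx intr (\col_i beta (f i))) j 0)).
  by apply: le_trans (ler_normD _ _) _; rewrite lerD ?entryE.
rewrite sumr_const card_ord -(mulr_natr (eps + _)) /eps.
have -> : (1 / (4 * (n + r)%:R) + 1 / (4 * (n + r)%:R)) * (n + r)%:R = 2^-1 :> R.
  by move: (n + r)%:R nr0 => p p0; field; rewrite gt_eqF.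
by rewrite invf_lt1 // ltr1n.
Qed.
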